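(* Let $N\in\mathbb{N}$, let $S_N=\{\mu^{(1)},\dots,\mu^{(N)}\}\subset\mathcal{P}$, and let $X_N\subset X^{\mathcal N}$, $Y_N\subset Y^{\mathcal N}$ be the reduced trial and test spaces associated with $S_N$ (defined in the context). For $\mu\in\mathcal{P}$ let $x_\mu^{\mathcal N}\in X^{\mathcal N}$ be the detailed approximation, i.e. the solution of $b(x_\mu^{\mathcal N},y)=f_\mu(y)$ for all $y\in Y^{\mathcal N}$, and let $x_N(\mu)\in X_N$ be the reduced approximation, i.e. the solution of $b(x_N(\mu),y)=f_\mu(y)$ for all $y\in Y_N$. Then for every $\mu\in\mathcal{P}$, $$\|x_\mu^{\mathcal N}-x_N(\mu)\|_{L_2}=\Delta_N(\mu):=\sup_{0\neq y\in Y^{\mathcal N}}\frac{f_\mu(y)-b(x_N(\mu),y)}{|||y|||}.$$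
   Context: Let $n,m\in\mathbb{N}$, $T>0$, $I=(0,T)$. Consider the fully linear parameterized differential-algebraic equation $E\dot x(t)-Ax(t)=Bu(t)+g_{\mu_2}(t)$, $t\in I$, $x(0)=0$, where $E,A\in\mathbb{R}^{n\times n}$ ($E$ typically singular) do not depend on the parameter, the pencil $\{E,-A\}$ is regular (i.e. $\det(\lambda E-A)\ne0$ for some $\lambda\in\mathbb{R}$), $B\in\mathbb{R}^{n\times m}$, and $g_{\mu_2}=\sum_{q=1}^{Q_x}\vartheta_q^x(\mu_2)\,(A\bar x_q-E\dot{\bar x}_q)$ with fixed $\bar x_q\in C^1(\bar I)^n$ and real-valued functions $\vartheta^x_q$ on a parameter set $\mathcal{P}_2\subset\mathbb{R}^{P_2}$. Write $(\cdot,\cdot)_{L_2}$, $\|\cdot\|_{L_2}$ for the inner product and norm of $L_2(I)^n=L_2(I;\mathbb{R}^n)$. Let $Y:=\{v\in H^1(I)^n:\ v(T)\in\ker(E^T)\}$, $B^*y:=-E^T\dot y-A^Ty$ for $y\in Y$, $|||y|||:=\|B^*y\|_{L_2}$, and $b(x,y):=(x,B^*y)_{L_2}$ for $x\in L_2(I)^n$, $y\in Y$. Discretization: let $K\in\mathbb{N}$, $\Delta t:=T/K$, $t_k:=k\Delta t$ for $k=0,\dots,K$, and let $\sigma_k:\bar I\to\mathbb{R}$ be the continuous piecewise linear (hat) function with respect to these nodes with $\sigma_k(t_\ell)=\delta_{k\ell}$. Let $d:=\dim\ker E^T$, let $\{v_1,\dots,v_d\}$ be a basis of $\ker E^T$,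 and let $e_1,\dots,e_n$ be the canonical basis of $\mathbb{R}^n$. Put $$Y^{\mathcal N}:=\mathrm{span}\{e_i\sigma_k:\ k=0,\dots,K-1,\ i=1,\dots,n\}\oplus\mathrm{span}\{v_i\sigma_K:\ i=1,\dots,d\}\subset Y,\qquad X^{\mathcal N}:=B^*Y^{\mathcal N}.$$ The parameter is $\mu=(\mu_1,\mu_2)\in\mathcal{P}:=\mathcal{P}_1\times\mathcal{P}_2$, where $\mathcal{P}_1=\mathbb{R}^{m(K+1)}$ and $\mu_1=(u(t_0),\dots,u(t_K))$ collects the samples of the control $u$ at the nodes. The right-hand side functional is obtained by piecewise linear interpolation in time: $f_\mu(y):=\sum_{k=0}^K\big((Bu(t_k)+g_{\mu_2}(t_k))\,\sigma_k,\,y\big)_{L_2}$. Reduced spaces: for each $\mu\in S_N$ there is a unique $y_\mu^{\mathcal N}\in Y^{\mathcal N}$ with $x_\mu^{\mathcal N}=B^*y_\mu^{\mathcal N}$; set $X_N:=\mathrm{span}\{x_\mu^{\mathcal N}:\mu\in S_N\}$ and $Y_N:=\mathrm{span}\{y_\mu^{\mathcal N}:\mu\in S_N\}$, so that $X_N=B^*Y_N$. *)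

(* Defs.v *)
From HB Require Import structures.
From mathcomp Require Import all_boot all_order all_algebra.
From mathcomp Require Import all_classical all_reals all_analysis.

Set Implicit Arguments.
Unset Strict Implicit.
Unset Printing Implicit Defensive.

Import Order.TTheory GRing.Theory Num.Theory.
Import numFieldNormedType.Exports.

Local Open Scope classical_set_scope.
Local Open Scope ring_scope.

(* Elements of L_2(I)^n, I = (0, T), are represented by functions
   x : R -> 'cV[R]_n; only the values on ]0, T[ matter, and equality in L_2 is
   ae_eqI. A function is in L_2(I) when its extension by zero is in L_2(R). *)
Definition inL2 (R : realType) (n : nat) (T : R) (x : R -> 'cV[R]_n) : Prop :=
  forall i, (fun t => x t i 0) \_ `]0, T[ \in Lfun (@lebesgue_measure R) 2%:E.

Definition ae_eqI (R : realType) (n : nat) (T : R) (x y : R -> 'cV[R]_n) : Prop :=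
  {ae (@lebesgue_measure R), forall t, t \in `]0, T[ -> x t = y t}.

Definition L2inner (R : realType) (n : nat) (T : R) (x y : R -> 'cV[R]_n) : R :=
  \int[@lebesgue_measure R]_(t in `]0, T[) (\sum_i x t i 0 * y t i 0).

Definition L2norm (R : realType) (n : nat) (T : R) (x : R -> 'cV[R]_n) : R :=
  Num.sqrt (L2inner T x x).

(* phi in C_c^1(I), the test functions in Brezis' definition of W^{1,p}(I). *)
Definition test_fun (R : realType) (T : R) (phi : R -> R) : Prop :=
  [/\ forall t, derivable phi t 1,
      continuous (derive1 phi),
      compact (closure [set t | phi t != 0]) &
      closure [set t | phi t != 0] `<=` `]0, T[ ].

Definition weak_derivative (R : realType) (n : nat) (T : R)
    (y w : R -> 'cV[R]_n) : Prop :=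
  inL2 T w /\
  forall (phi : R -> R) (i : 'I_n), test_fun T phi ->
    \int[@lebesgue_measure R]_(t in `]0, T[) (y t i 0 * derive1 phi t) =
    - \int[@lebesgue_measure R]_(t in `]0, T[) (w t i 0 * phi t).

(* H^1(I)^n, each class being represented by its continuous representative
   on [0, T], so that the trace at T is the value y T. *)
Definition H1 (R : realType) (n : nat) (T : R) : set (R -> 'cV[R]_n) :=
  [set y : R -> 'cV[R]_n | [/\ forall i, {within `[0, T], continuous (fun t => y t i 0)},
               inL2 T y & exists w, weak_derivative T y w]].

Definition kerT (R : realType) (n : nat) (E : 'M[R]_n) : {vspace 'cV[R]_n} :=
  lker (linfun (mulmx E^T)).

Definition Yspace (R : realType) (n : nat) (T : R) (E : 'M[R]_n) :
    set (R -> 'cV[R]_n) :=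
  [set y : R -> 'cV[R]_n | H1 T y /\ y T \in kerT E].

(* A representative of the weak derivative: it is unique up to ae_eqI, and it
   is meaningful for y in H1 (otherwise the default value 0 is returned).
   Hence Bstar is an operator on Yspace, which contains the space Yh below. *)
Definition wderiv (R : realType) (n : nat) (T : R) (y : R -> 'cV[R]_n) :
    R -> 'cV[R]_n :=
  xget 0 [set w | weak_derivative T y w].

Definition Bstar (R : realType) (n : nat) (T : R) (E A : 'M[R]_n)
    (y : R -> 'cV[R]_n) : R -> 'cV[R]_n :=
  fun t => - (E^T *m wderiv T y t) - A^T *m y t.

Definition bform (R : realType) (n : nat) (T : R) (E A : 'M[R]_n)
    (x y : R -> 'cV[R]_n) : R :=
  L2inner T x (Bstar T E A y).

Definition Ynorm (R : realType) (n : nat) (T : R) (E A : 'M[R]_n)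
    (y : R -> 'cV[R]_n) : R :=
  L2norm T (Bstar T E A y).

Definition regular_pencil (R : realType) (n : nat) (E A : 'M[R]_n) : Prop :=
  exists lambda : R, \det (lambda *: E - A) != 0.

(* x in C^1([0, T])^n with derivative dx; dx is the continuous extension to
   [0, T] of the derivative on ]0, T[, hence one-sided at 0 and T. *)
Definition C1_with (R : realType) (n : nat) (T : R) (x dx : R -> 'cV[R]_n) :
    Prop :=
  forall i,
    [/\ {within `[0, T], continuous (fun t => x t i 0)},
        {within `[0, T], continuous (fun t => dx t i 0)} &
        forall t, t \in `]0, T[ -> is_derive t 1 (fun s => x s i 0) (dx t i 0)].

Definition span_fam (R : realType) (V : lmodType R) (I : finType) (F : I -> V) :
    set V :=
  [set y | exists c : I -> R, y = \sum_i c i *: F i].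

Definition span_set (R : realType) (V : lmodType R) (S : set V) : set V :=
  [set y | exists (k : nat) (F : 'I_k -> V), (forall i, S (F i)) /\ span_fam F y].

Definition node (R : realType) (T : R) (K k : nat) : R := k%:R * (T / K%:R).

(* The hat function at the k-th node of the uniform grid with K cells; the
   formula extends it canonically from [0, T] to the real line. *)
Definition hat (R : realType) (T : R) (K k : nat) (t : R) : R :=
  Num.max 0 (1 - `|t - node T K k| / (T / K%:R)).

Definition Yh (R : realType) (n : nat) (T : R) (K : nat) (E : 'M[R]_n)
    (v : (\dim (kerT E)).-tuple 'cV[R]_n) : set (R -> 'cV[R]_n) :=
  [set y | exists y1 y2 : R -> 'cV[R]_n,
     [/\ span_fam (fun ki : 'I_K * 'I_n =>
           (fun t => hat T K ki.1 t *: delta_mx ki.2 0) : R -> 'cV[R]_n) y1,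
         span_fam (fun i : 'I_(\dim (kerT E)) =>
           (fun t => hat T K K t *: tnth v i) : R -> 'cV[R]_n) y2 &
         y = y1 + y2]].

(* The image of Y under Bstar, as a set of elements of L_2(I)^n: all the
   representatives are included. *)
Definition Bstar_image (R : realType) (n : nat) (T : R) (E A : 'M[R]_n)
    (Y : set (R -> 'cV[R]_n)) : set (R -> 'cV[R]_n) :=
  [set x | inL2 T x /\ exists2 y, Y y & ae_eqI T x (Bstar T E A y)].

(* Parameters: column k of mu.1 is the control sample u(t_k), and mu.2 is mu_2. *)
Definition param (R : realType) (m K p : nat) : Type :=
  ('M[R]_(m, K.+1) * 'rV[R]_p)%type.

Definition gfun (R : realType) (n p Q : nat) (E A : 'M[R]_n)
    (theta : 'I_Q -> 'rV[R]_p -> R) (xbar dxbar : 'I_Q -> R -> 'cV[R]_n)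
    (mu2 : 'rV[R]_p) (t : R) : 'cV[R]_n :=
  \sum_q theta q mu2 *: (A *m xbar q t - E *m dxbar q t).

Definition rhs (R : realType) (n m K p Q : nat) (T : R) (E A : 'M[R]_n)
    (B : 'M[R]_(n, m)) (theta : 'I_Q -> 'rV[R]_p -> R)
    (xbar dxbar : 'I_Q -> R -> 'cV[R]_n) (mu : param R m K p)
    (y : R -> 'cV[R]_n) : R :=
  \sum_(k < K.+1)
    L2inner T
      (fun t => hat T K k t *:
         (B *m col k mu.1 + gfun E A theta xbar dxbar mu.2 (node T K k))) y.

(* x is a solution in X of: b(x, y) = f(y) for all y in Y. *)
Definition galerkin_sol (R : realType) (n : nat) (T : R) (E A : 'M[R]_n)
    (X Y : set (R -> 'cV[R]_n)) (f : (R -> 'cV[R]_n) -> R)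
    (x : R -> 'cV[R]_n) : Prop :=
  X x /\ forall y, Y y -> bform T E A x y = f y.

(* Reduced spaces X_N, Y_N generated by the snapshots for the parameters in S,
   where X, Y are the detailed spaces and f mu the right-hand side. All the
   representatives of a snapshot are taken, which makes XN closed under
   ae_eqI within L_2 (as soon as there is a snapshot). *)
Definition XN (R : realType) (n : nat) (P : Type) (T : R) (E A : 'M[R]_n)
    (X Y : set (R -> 'cV[R]_n)) (f : P -> (R -> 'cV[R]_n) -> R) (S : set P) :
    set (R -> 'cV[R]_n) :=
  span_set [set x | exists2 mu, S mu & galerkin_sol T E A X Y (f mu) x].

Definition YN (R : realType) (n : nat) (P : Type) (T : R) (E A : 'M[R]_n)
    (X Y : set (R -> 'cV[R]_n)) (f : P -> (R -> 'cV[R]_n) -> R) (S : set P) :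
    set (R -> 'cV[R]_n) :=
  span_set [set y | Y y /\
    exists mu x, [/\ S mu, galerkin_sol T E A X Y (f mu) x &
                     ae_eqI T x (Bstar T E A y)]].

(* The supremum is taken in the extended reals, where it always exists. *)
Definition DeltaN (R : realType) (n : nat) (T : R) (E A : 'M[R]_n)
    (Y : set (R -> 'cV[R]_n)) (f : (R -> 'cV[R]_n) -> R)
    (xN : R -> 'cV[R]_n) : \bar R :=
  ereal_sup [set ((f y - bform T E A xN y) / Ynorm T E A y)%:E |
              y in [set y | Y y /\ y <> 0]].

(* Main.v *)
Require Import Defs.
From mathcomp Require Import all_boot all_order all_algebra.
From mathcomp Require Import all_classical all_reals all_analysis.
From mathcomp Require Import ring lra measurable_realfun.

Set Implicit Arguments.
Unset Strict Implicit.
Unset Printing Implicit Defensive.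

Import Order.TTheory GRing.Theory Num.Theory.
Import numFieldNormedType.Exports.
Local Open Scope classical_set_scope.
Local Open Scope ring_scope.

(** The trial space is the image of the test space under [Bstar], and the norm
on the test space is the L_2-norm of that image. Hence the error e = x - xN
is itself [Bstar z] for some z in the test space, the residual at y is the
inner product of e with [Bstar y], and the two inequalities between its dual
norm and the norm of e are Cauchy-Schwarz and the choice y = z
([residual_dual_norm]).

That argument uses that [Bstar] is linear on the test space, up to equality
almost everywhere. As [Bstar] picks some weak derivative of its argument, this
needs two facts. First, elements of the test space have weak derivatives: a
hat function is a combination of three ramps max(0, t - c) ([hat_ramp]), and
integration by parts shows that a ramp has a step function as weak derivative
([ramp_by_parts]). Secondly, weak derivatives are unique almost everywhere
([weak_derivative_unique]). This is the fundamental lemma of the calculus of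
variations ([fundamental_lemma]): if w is orthogonal to all test functions
then, letting test functions converge to the indicator of an interval, w has
integral zero over each compactly contained interval, and w = 0 almost
everywhere by Lebesgue differentiation.

Linearity also carries the reduced solution into the image of the test space,
since each snapshot lies there ([Bstar_image_lin_closed],
[span_set_sub]). *)

(** * Square integrable functions on the time interval *)

Section SquareIntegrable.
Context (R : realType) (T : R).
Local Notation mu := (@lebesgue_measure R).

(** The condition that [inL2] puts on each component. *)
Definition sqint (f : R -> R) := f \_ `]0, T[ \in Lfun mu 2%:E.

Lemma lebesgue_itv_lty : (mu `]0%R, T[%classic < +oo)%E.
Proof.
by rewrite lebesgue_measure_itv/=; case: ifPn => _; rewrite ?ltry// -EFinB ltry.
Qed.

Lemma sqint_measurable f : sqint f -> measurable_fun `]0, T[ f.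
Proof.
move=> /sub_Lfun_mfun; rewrite inE/= => mf.
exact/(measurable_restrictT _ _).2.
Qed.

Lemma sqint_bounded (f : R -> R) (M : R) : measurable_fun `]0, T[ f ->
  (forall t, t \in `]0, T[ -> `|f t| <= M) -> sqint f.
Proof.
move=> mf fM; rewrite /sqint inE; apply/andP; split; rewrite inE/=.
  exact/(measurable_restrictT _ _).1.
rewrite /finite_norm unlock /Lnorm; apply: poweR_lty.
apply: (@le_lt_trans _ _ (\int[mu]_(t in `]0%R, T[) (`|f t| `^ 2)%:E)%E).
  rewrite [leRHS]integral_mkcond le_eqVlt; apply/orP; left; apply/eqP.
  apply: eq_integral => t _ /=; rewrite !patchE; case: ifPn => //= _.
  by rewrite normr0 powR0.
have mf2 : measurable_fun `]0, T[ (fun t => `|f t| `^ 2).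
  apply: (@measurableT_comp _ _ _ _ _ _ (fun x : R => x `^ 2)) => //.
  exact: measurableT_comp.
apply: (@le_lt_trans _ _ (\int[mu]_(t in `]0%R, T[) (M `^ 2)%:E)%E).
  apply: ge0_le_integral => //; first exact/measurable_EFinP.
  move=> t tT; rewrite lee_fin.
  by rewrite ge0_ler_powR ?nnegrE// ?fM// (le_trans _ (fM t tT)).
by rewrite integral_cst// lte_mul_pinfty ?lee_fin ?powR_ge0// lebesgue_itv_lty.
Qed.

Lemma sqint0 : sqint (fun=> 0).
Proof. by apply: (@sqint_bounded _ 0) => // t _; rewrite normr0. Qed.

Lemma sqint_lin (a : R) (f g : R -> R) : sqint f -> sqint g ->
  sqint (fun t => a * f t + g t).
Proof.
rewrite /sqint => hf hg.
rewrite (_ : _ \_ _ = a *: (f \_ `]0, T[) + g \_ `]0, T[).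
  by apply: (Lfun_submod_closed mu (lee1n 2)).2.
apply/funext => t; rewrite !fctE !patchE; case: ifPn => _ //.
by rewrite scaler0 addr0.
Qed.

Lemma sqint_mul_integrable (f g : R -> R) : sqint f -> sqint g ->
  mu.-integrable `]0, T[ (EFin \o (fun t => f t * g t)).
Proof.
move=> hf hg; apply/(integrable_mkcond _ _).2 => //.
have /Lfun1_integrable := Lfun2_mul_Lfun1 hf hg.
congr (mu.-integrable _ _); apply/funext => t /=.
by rewrite !patchE; case: ifPn => //; rewrite mul0r.
Qed.

(** The interval has finite measure, so the constant 1 can serve as the second
factor. *)
Lemma sqint_integrable f : sqint f -> mu.-integrable `]0, T[ (EFin \o f).
Proof.
move=> hf; have h1 : sqint (fun=> 1).
  by apply: (@sqint_bounded _ 1) => // t _; rewrite normr1.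
have := sqint_mul_integrable hf h1.
by congr (mu.-integrable _ _); apply/funext => t /=; rewrite mulr1.
Qed.

Lemma sqint_continuous (f : R -> R) : continuous f -> sqint f.
Proof.
move=> cf; have [M [_ hM]] : bounded_set (f @` `[0, T]).
  apply/compact_bounded/continuous_compact; last exact: segment_compact.
  exact: continuous_subspaceT.
apply: (@sqint_bounded _ (`|M| + 1)).
  apply: (@measurable_funS _ _ _ _ setT) => //.
  exact: continuous_measurable_fun.
move=> t t0T; apply: (hM (`|M| + 1)).
  by rewrite (le_lt_trans (ler_norm M))// ltrDl.
exists t => //=; move: t0T; rewrite !in_itv/= => /andP[/ltW-> /ltW->]//.
Qed.

End SquareIntegrable.

(** * Continuously differentiable test functions approximating an indicator *)

Section Bump.
Context (R : realType).

(** Squaring the positive part makes this bump C^1 across the end points a and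
b, where the positive part alone has kinks. *)
Definition sqbump (a b t : R) : R := (Num.max 0 ((t - a) * (b - t))) ^+ 2.

(** The increment of max(0, y)^2 over a step h differs from its linear part by
at most h^2, uniformly in the position; this covers the point 0 without a
separate argument. *)
Lemma is_derive_max0_sqr (x : R) :
  is_derive x 1 (fun y : R => (Num.max 0 y) ^+ 2) (2 * Num.max 0 x).
Proof.
have E : (fun h : R => h^-1 *: ((Num.max 0 (h *: 1 + x)) ^+ 2 - (Num.max 0 x) ^+ 2))
    @ 0^' --> 2 * Num.max 0 x.
  apply/cvgrPdist_le => e e0.
  near=> h.
  have h0 : h != 0 by near: h; exact: nbhs_dnbhs_neq.
  have he : `|h| <= e by near: h; apply: dnbhs0_le.
  apply: le_trans he; rewrite /GRing.scale/= mulr1.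
  rewrite -(@ler_pM2l _ `|h|) ?normr_gt0// -normrM mulrBr mulVKf//.
  rewrite -normrM -expr2 [in leRHS]ger0_norm ?sqr_ge0// ler_norml.
  case: (leP 0 x) => x0; case: (leP 0 (h + x)) => hx0; apply/andP; split; nra.
by apply: DeriveDef; [apply/cvg_ex; eexists; exact: E | apply/cvg_lim => //].
Unshelve. all: by end_near. Qed.

Lemma is_derive_bump (a b t : R) : is_derive t 1 (sqbump a b)
  (2 * Num.max 0 ((t - a) * (b - t)) * (a + b - 2 * t)).
Proof.
have h1 : is_derive t 1 (fun s : R => (s - a) * (b - s)) (a + b - 2 * t).
  apply: trigger_derive; rewrite /GRing.scale/=; ring.
have h2 := is_derive_max0_sqr ((t - a) * (b - t)).
exact: (@is_derive1_comp _ (fun y : R => (Num.max 0 y) ^+ 2)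
  (fun s : R => (s - a) * (b - s)) t _ _ h2 h1).
Qed.

Lemma bump_ge0 (a b t : R) : 0 <= sqbump a b t.
Proof. exact: sqr_ge0. Qed.

Lemma bump_eq0 (a b t : R) : a < b -> t \notin `]a, b[ -> sqbump a b t = 0.
Proof.
move=> ab; rewrite in_itv/= negb_and -!leNgt => /orP h.
rewrite /sqbump; suff -> : Num.max 0 ((t - a) * (b - t)) = 0 by rewrite expr0n.
by apply/max_idPl; case: h => h; nra.
Qed.

Lemma bump_gt0 (a b t : R) : t \in `]a, b[ -> 0 < sqbump a b t.
Proof.
rewrite in_itv/= => /andP[h1 h2].
have h : 0 < (t - a) * (b - t) by rewrite mulr_gt0 ?subr_gt0.
by rewrite /sqbump exprn_gt0// lt_max h orbT.
Qed.

Lemma bump_continuous (a b : R) : continuous (sqbump a b).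
Proof.
move=> t; apply/differentiable_continuous/derivable1_diffP.
exact: (@ex_derive _ _ _ _ _ _ _ (is_derive_bump a b t)).
Qed.

(** As e tends to 0, this tends to 1 where the bump is positive and is 0
elsewhere, while it remains between 0 and 1. *)
Definition plateau (a b e t : R) : R := sqbump a b t / (sqbump a b t + e).

Lemma bumpD_gt0 (a b e t : R) : 0 < e -> 0 < sqbump a b t + e.
Proof. by move=> e0; rewrite ltr_wpDl// bump_ge0. Qed.

Lemma is_derive_plateau (a b e t : R) : 0 < e ->
  is_derive t 1 (plateau a b e)
    (e * (2 * Num.max 0 ((t - a) * (b - t)) * (a + b - 2 * t))
       / (sqbump a b t + e) ^+ 2).
Proof.
move=> e0; have he := bumpD_gt0 a b t e0.
have hd := is_derive_bump a b t.
have hD : is_derive t 1 (fun s => sqbump a b s + e)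
    (2 * Num.max 0 ((t - a) * (b - t)) * (a + b - 2 * t)).
  by apply: trigger_derive; rewrite addr0.
have hV : is_derive t 1 (fun s => (sqbump a b s + e)^-1)
    (- (sqbump a b t + e) ^- 2 *:
      (2 * Num.max 0 ((t - a) * (b - t)) * (a + b - 2 * t))).
  by apply: (is_deriveV (f := fun s => sqbump a b s + e)); rewrite gt_eqF.
apply: trigger_derive.
rewrite /GRing.scale/=; field.
by rewrite gt_eqF.
Qed.

Lemma plateau_eq0 (a b e t : R) : a < b -> t \notin `]a, b[ -> plateau a b e t = 0.
Proof. by move=> ab tab; rewrite /plateau bump_eq0// mul0r. Qed.

Lemma plateau_test_fun (T a b e : R) : 0 < a -> a < b -> b < T -> 0 < e ->
  test_fun T (plateau a b e).
Proof.
move=> a0 ab bT e0.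
have sub : closure [set t | plateau a b e t != 0] `<=` `[a, b].
  rewrite [X in _ `<=` X](closure_id _).1; last exact: itv_closed.
  apply: closure_subset => t /= tn0.
  apply: subset_itv_oo_cc.
  by apply: contraNT tn0 => tab; apply/eqP/plateau_eq0.
split.
- by move=> t; exact: (@ex_derive _ _ _ _ _ _ _ (is_derive_plateau a b t e0)).
- rewrite (_ : derive1 _ = fun t =>
    (e * (2 * Num.max 0 ((t - a) * (b - t)) * (a + b - 2 * t))
       / (sqbump a b t + e) ^+ 2)); last first.
    apply/funext => t; rewrite derive1E.
    exact: (@derive_val _ _ _ _ _ _ _ (is_derive_plateau a b t e0)).
  move=> t; apply: cvgM; last first.
    apply: cvgV; first by rewrite sqrf_eq0 gt_eqF// bumpD_gt0.
    apply: (@continuous_comp _ _ _ (fun t => sqbump a b t + e) (fun x => x ^+ 2));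
      last exact: exprn_continuous.
    by apply: cvgD; [exact: bump_continuous | exact: cvg_cst].
  apply: cvgM; first exact: cvg_cst.
  apply: cvgM.
    apply: cvgM; first exact: cvg_cst.
    apply: (@continuous_max _ _ (fun=> 0) (fun t : R => (t - a) * (b - t)));
      first exact: cvg_cst.
    by apply: cvgM; apply: cvgB => //; [exact: cvg_cst|exact: cvg_cst].
  apply: cvgB; first exact: cvg_cst.
  by apply: cvgM => //; exact: cvg_cst.
- apply: (subclosed_compact _ (@segment_compact _ a b) sub).
  exact: closed_closure.
- apply: (subset_trans sub) => t /=; rewrite !in_itv/= => /andP[h1 h2].
  by rewrite (lt_le_trans a0 h1) (le_lt_trans h2 bT).
Qed.

Lemma plateau_continuous (a b e : R) : 0 < e -> continuous (plateau a b e).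
Proof.
move=> e0 t; apply/differentiable_continuous/derivable1_diffP.
exact: (@ex_derive _ _ _ _ _ _ _ (is_derive_plateau a b t e0)).
Qed.

Lemma plateau_norm_le1 (a b e t : R) : 0 < e -> `|plateau a b e t| <= 1.
Proof.
move=> e0; have h := bumpD_gt0 a b t e0; have h' := bump_ge0 a b t.
rewrite ger0_norm; first by rewrite ler_pdivrMr// mul1r lerDl ltW.
by rewrite divr_ge0// ltW.
Qed.

Lemma plateau_cvg (a b t : R) : a < b ->
  (fun k => plateau a b (harmonic k) t) @ \oo --> (\1_(`]a, b[ : set R) t : R).
Proof.
move=> ab; rewrite indicE mem_setE; case: (boolP (t \in `]a, b[)) => tab.
  have h := bump_gt0 tab.
  rewrite (_ : (true%:R : R) = sqbump a b t / (sqbump a b t + 0)); last first.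
    by rewrite addr0 divff// gt_eqF.
  apply: cvgM; first exact: cvg_cst.
  apply: cvgV; first by rewrite addr0 gt_eqF.
  by apply: cvgD; [exact: cvg_cst | exact: cvg_harmonic].
under eq_cvg do rewrite plateau_eq0//.
exact: cvg_cst.
Qed.

End Bump.

(** * The fundamental lemma of the calculus of variations *)

Section Fundamental.
Context (R : realType) (T : R).
Local Notation mu := (@lebesgue_measure R).

(** Dominated convergence along the plateaus with e = 1 / (k + 1), whose limit
is the indicator of ]a, b[; the dominating function is |w|. *)
Lemma fundamental_itv (w : R -> R) (a b : R) : sqint T w ->
  (forall phi, test_fun T phi -> \int[mu]_(t in `]0, T[) (w t * phi t) = 0) ->
  0 < a -> a < b -> b < T -> \int[mu]_(t in `]a, b[) w t = 0.
Proof.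
move=> hw h0 a0 ab bT.
have iw := sqint_integrable hw.
have mw := sqint_measurable hw.
have mp k : measurable_fun `]0, T[ (plateau a b (harmonic k)).
  apply: (@measurable_funS _ _ _ _ setT) => //.
  by apply: continuous_measurable_fun; exact/plateau_continuous/harmonic_gt0.
have mi : measurable (`]a, b[%classic : set R) by exact: measurable_itv.
have [|||||_ _] := @dominated_convergence _ _ _ mu `]0, T[%classic
  (measurable_itv _)
  (fun k t => (w t * plateau a b (harmonic k) t)%:E)
  (fun t => (w t * \1_(`]a, b[%classic : set R) t)%:E)
  (fun t => `|w t|%:E).
- move=> k; apply/measurable_EFinP; apply: measurable_funM => //; exact: mp.
- by apply/measurable_EFinP; apply: measurable_funM.
- apply: aeW => t _; apply: cvg_EFin; first exact: nearW.
  by apply: cvgM; [exact: cvg_cst | exact: plateau_cvg].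
- exact: integrable_norm.
- apply: aeW => t k _ /=; rewrite lee_fin normrM ler_piMr//.
  by apply: plateau_norm_le1; exact: harmonic_gt0.
rewrite (_ : [sequence _]_n = fun=> 0%E); last first.
  apply/funext => k; have := h0 _ (plateau_test_fun a0 ab bT (harmonic_gt0 k)).
  have fn : (\int[mu]_(t in `]0%R, T[) (w t * plateau a b (harmonic k) t)%:E)%E
      \is a fin_num.
    apply: integrable_fin_num => //; apply: (sqint_mul_integrable hw).
    apply: sqint_continuous.
    by apply: plateau_continuous; exact: harmonic_gt0.
  by rewrite /Rintegral => h; rewrite /= -[LHS](fineK fn) h.
move=> /cvg_lim; rewrite lim_cst// => h.
rewrite /Rintegral -[RHS]/(fine 0%E) h//; congr fine.
transitivity (\int[mu]_(t in `]0%R, T[ `&` `]a, b[) (w t)%:E)%E.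
  congr (integral _ _ _).
  apply/seteqP; split => [t|t []//] tab; split => //; move: tab.
  by rewrite /= !in_itv/= => /andP[h1 h2]; rewrite (lt_trans a0)// (lt_trans h2).
rewrite integral_mkcondr; apply: eq_integral => t _.
by rewrite patchE indicE; case: (_ \in _); rewrite ?mulr1 ?mulr0.
Qed.

(** Near a Lebesgue point x in ]0, T[, the primitive of w that starts from x / 2
vanishes by [fundamental_itv]; its derivative at x is w x. The starting point
x / 2 rather than 0 keeps the intervals compactly inside ]0, T[. *)
Lemma fundamental_lemma (w : R -> R) : sqint T w ->
  (forall phi, test_fun T phi -> \int[mu]_(t in `]0, T[) (w t * phi t) = 0) ->
  {ae mu, forall t, t \in `]0, T[ -> w t = 0}.
Proof.
move=> hw h0.
have iw := sqint_integrable hw.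
pose g := w \_ `]0, T[.
have ig : mu.-integrable setT (EFin \o g).
  by rewrite /g -restrict_EFin; apply: (integrable_mkcond _ _).1 => //;
    exact: measurable_itv.
have lg : locally_integrable setT g by apply: integrable_locally.
have := lebesgue_differentiation lg.
apply: (@filterS _ _ (ae_filter_ringOfSetsType mu)) => x Lx.
rewrite in_itv/= => /andP[x0 xT].
have -> : w x = g x by rewrite /g patchE mem_set//= in_itv/= x0.
have x2 : 0 < x / 2 by rewrite divr_gt0.
have x2x : x / 2 < x by rewrite ltr_pdivrMr// ltr_pMr// ltr1n.
pose F y := \int[mu]_(t in `]x / 2, y]) g t.
have [] := @FTC1_lebesgue_pt _ g (BRight (x / 2)) x T xT _ _ Lx.
- by apply: integrableS ig.
- by rewrite lte_fin.
move=> _ <-; rewrite derive1E.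
have FE : \forall y \near x, F y = 0.
  near=> y.
  have yx : x / 2 < y by near: y; exact: lt_nbhsr.
  have yT : y < T by near: y; exact: lt_nbhsl.
  rewrite /F -Rintegral_itv_bndo_bndc; last by apply: integrableS ig.
  rewrite -[RHS](fundamental_itv hw h0 x2 yx yT).
  apply: eq_Rintegral => t; rewrite inE/= in_itv/= => /andP[h1 h2].
  by rewrite /g patchE mem_set//= in_itv/= (lt_trans x2 h1) (lt_trans h2 yT).
rewrite (near_eq_derive _ (g := cst 0)) ?derive_cst//.
Unshelve. all: by end_near. Qed.

End Fundamental.

(** * Ramps and hat functions *)

Section Ramp.
Context (R : realType) (T : R).
Local Notation mu := (@lebesgue_measure R).

Definition ramp (c t : R) : R := Num.max 0 (t - c).

Lemma ramp_continuous (c : R) : continuous (ramp c).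
Proof.
move=> x; apply: (@continuous_max _ _ (fun=> 0) (fun t : R => t - c)).
  exact: cvg_cst.
by apply: cvgB => //; exact: cvg_cst.
Qed.

(** Stated for functions on R itself: [eq_Rintegral] infers another canonical
measurable structure on R than the one carried by the Lebesgue measure. *)
Lemma eq_lebesgue_Rintegral (A : set R) (f g : R -> R) :
  (forall t, A t -> f t = g t) ->
  \int[mu]_(t in A) f t = \int[mu]_(t in A) g t.
Proof. by move=> fg; apply: eq_Rintegral => t /[1!inE]; exact: fg. Qed.

Lemma eq_Rintegral_vanish (A B : set R) (f : R -> R) :
  (forall t, ~ A t -> f t = 0) -> (forall t, ~ B t -> f t = 0) ->
  \int[mu]_(t in A) f t = \int[mu]_(t in B) f t.
Proof.
have E (D : set R) : (forall t, ~ D t -> f t = 0) -> f \_ D = f.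
  move=> h; apply/funext => t; rewrite patchE; case: ifPn => // /negP tD.
  by rewrite h// => Dt; apply: tD; rewrite inE.
by move=> hA hB; rewrite Rintegral_mkcond (E _ hA) [RHS]Rintegral_mkcond (E _ hB).
Qed.

Lemma test_fun_out phi t : test_fun T phi -> t \notin `]0, T[ ->
  phi t = 0 /\ derive1 phi t = 0.
Proof.
move=> [_ _ _ sub] tT.
have nt : ~ closure [set t | phi t != 0] t by move/sub => /= h; rewrite h in tT.
have FE : \forall y \near t, phi y = 0.
  have : nbhs t (~` closure [set t | phi t != 0]).
    by apply: open_nbhs_nbhs; split => //; exact/closed_openC/closed_closure.
  apply: filterS => y ny; apply/eqP; apply: contra_notT ny => y0.
  exact: subset_closure.
split; first exact: nbhs_singleton FE.
by rewrite derive1E (near_eq_derive _ (g := cst 0)) ?derive_cst.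
Qed.

Lemma test_fun_continuous phi : test_fun T phi -> continuous phi.
Proof.
move=> [d _ _ _] t; apply/differentiable_continuous/derivable1_diffP; exact: d.
Qed.

(** Both integrands vanish outside ]0, T[ and, when M is larger than c and T,
also outside [c, M], so that the integrals can be moved to [c, M] whatever the
position of c. There the ramp is t - c and the step, taken to be 1 at c, is
constant; both boundary terms of the integration by parts vanish, since the ramp
is 0 at c and the test function is 0 at M. *)
Lemma ramp_by_parts (c : R) phi : test_fun T phi ->
  \int[mu]_(t in `]0, T[) (ramp c t * derive1 phi t) =
  - \int[mu]_(t in `]0, T[) ((c <= t)%R%:R * phi t).
Proof.
move=> tp; pose M := Num.max T c + 1.
have TM : T < M by rewrite (@le_lt_trans _ _ (Num.max T c)) ?le_max ?lexx// ltrDl.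
have cM : c < M.
  by rewrite (@le_lt_trans _ _ (Num.max T c)) ?le_max ?lexx ?orbT// ltrDl.
have out t : ~ `]0, T[%classic t -> phi t = 0 /\ derive1 phi t = 0.
  by move=> tT; apply: test_fun_out => //; apply/negP.
have outM t : M <= t -> phi t = 0 /\ derive1 phi t = 0.
  move=> Mt; apply: out; rewrite /= in_itv/= => /andP[_ tT].
  by have := lt_trans (le_lt_trans Mt tT) TM; rewrite ltxx.
have outcM t : ~ `[c, M]%classic t -> t < c \/ (phi t = 0 /\ derive1 phi t = 0).
  rewrite /= in_itv/= => /negP; rewrite negb_and -!ltNge => /orP[|/ltW].
    by left.
  by move=> /outM; right.
rewrite (@eq_Rintegral_vanish _ `[c, M]); last 2 first.
- by move=> t /out[_ ->]; rewrite mulr0.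
- move=> t /outcM[tc|[_ ->]]; last by rewrite mulr0.
  rewrite /ramp (_ : Num.max _ _ = 0) ?mul0r//.
  by apply/max_idPl; rewrite subr_le0 ltW.
rewrite [in RHS](@eq_Rintegral_vanish _ `[c, M]); last 2 first.
- by move=> t /out[-> _]; rewrite mulr0.
- move=> t /outcM[tc|[-> _]]; last by rewrite mulr0.
  by rewrite leNgt tc mul0r.
have [d1 d2 _ _] := tp.
have cphi := test_fun_continuous tp.
have dF t : is_derive t (1 : R) (fun s : R => s - c) 1.
  by apply: trigger_derive; rewrite subr0.
have cF : continuous (fun s : R => s - c).
  by move=> t; apply: cvgB => //; exact: cvg_cst.
rewrite (@eq_lebesgue_Rintegral _ _ (fun t : R => (t - c) * derive1 phi t));
    last first.
  move=> t; rewrite /= in_itv/= => /andP[ct _]; congr (_ * _).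
  by apply/max_idPr; rewrite subr_ge0.
rewrite [in RHS](@eq_lebesgue_Rintegral _ _ (fun t : R => 1 * phi t)); last first.
  by move=> t; rewrite /= in_itv/= => /andP[-> _].
rewrite (@Rintegration_by_parts _ (fun s : R => s - c) phi (fun=> 1)
  (derive1 phi))//.
- by rewrite (outM M _).1// subrr mulr0 mul0r subr0 sub0r.
- by apply: continuous_subspaceT => t; exact: cvg_cst.
- split; first by move=> t _; exact: (@ex_derive _ _ _ _ _ _ _ (dF t)).
    exact/cvg_at_right_filter/cF.
  exact/cvg_at_left_filter/cF.
- by move=> t _; rewrite derive1E (@derive_val _ _ _ _ _ _ _ (dF t)).
- exact: continuous_subspaceT.
- split; first by move=> t _; exact: d1.
    exact/cvg_at_right_filter/cphi.
  exact/cvg_at_left_filter/cphi.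
Qed.

(** A hat function is a scaled second difference of ramps. *)
Lemma hat_ramp (K k : nat) (t : R) : 0 < T -> (0 < K)%N ->
  let h := T / K%:R in let c := node T K k in
  hat T K k t = h^-1 * (ramp (c - h) t + (-2) * ramp c t + ramp (c + h) t).
Proof.
move=> T0 K0 h c.
have h0 : 0 < h by rewrite divr_gt0// ltr0n.
rewrite /hat -/h -/c.
have -> : 1 - `|t - c| / h = h^-1 * (h - `|t - c|).
  by rewrite mulrBr mulVf ?gt_eqF// mulrC.
rewrite -[X in Num.max X _](mulr0 h^-1) -maxr_pMr ?invr_ge0 ?ltW//.
congr (_ * _); rewrite /ramp.
have [h1|h1] := leP 0 (t - c); [rewrite (ger0_norm h1)|rewrite (ltr0_norm h1)];
case: (leP 0 (h - _)) => h2; case: (leP 0 (t - (c - h))) => h3;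
case: (leP 0 (t - (c + h))) => h4; lra.
Qed.

End Ramp.

(** * Linear spaces and the vector-valued L_2 space *)

Section LinClosed.
Context (R : realType) (V : lmodType R).

Definition lin_closed (Y : set V) :=
  Y 0 /\ forall a x y, Y x -> Y y -> Y (a *: x + y).

Lemma lin_closed_sum (Y : set V) (I : finType) (c : I -> R) (F : I -> V) :
  lin_closed Y -> (forall i, Y (F i)) -> Y (\sum_i c i *: F i).
Proof.
move=> [Y0 YD] YF; apply: (@big_ind _ Y) => //.
  by move=> x y Yx Yy; rewrite -[x]scale1r; exact: YD.
by move=> i _; rewrite -[_ *: _]addr0; exact: YD.
Qed.

Lemma span_fam_lin_closed (I : finType) (F : I -> V) : lin_closed (span_fam F).
Proof.
split; first by exists (fun=> 0); rewrite big1// => i _; rewrite scale0r.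
move=> a _ _ [c1 ->] [c2 ->]; exists (fun i => a * c1 i + c2 i).
rewrite scaler_sumr -big_split/=; apply: eq_bigr => i _.
by rewrite scalerDl scalerA.
Qed.

Lemma span_set_sub (S Y : set V) : lin_closed Y -> S `<=` Y -> span_set S `<=` Y.
Proof.
move=> lY SY _ [k [F [SF [c ->]]]]; apply: lin_closed_sum => // i.
exact/SY/SF.
Qed.

End LinClosed.

Section L2space.
Context (R : realType) (n : nat) (T : R).
Local Notation mu := (@lebesgue_measure R).
Implicit Types x y z : R -> 'cV[R]_n.

Lemma lin_entry (a : R) x y t i :
  (a *: x + y) t i 0 = a * x t i 0 + y t i 0.
Proof. by rewrite -[LHS]/((a *: x t + y t) i 0) !mxE. Qed.

Lemma inL2P x : inL2 T x <-> forall i, sqint T (fun t => x t i 0).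
Proof. by []. Qed.

Lemma inL2_lin_closed : lin_closed (@inL2 R n T).
Proof.
split.
  move=> i; have -> : (fun t => (0 : R -> 'cV[R]_n) t i 0) = fun=> 0;
    last exact: sqint0.
  by apply/funext => t; rewrite -[LHS]/((0 : 'cV[R]_n) i 0) mxE.
move=> a x y hx hy i.
have -> : (fun t => (a *: x + y) t i 0) = fun t => a * x t i 0 + y t i 0.
  by apply/funext => t; rewrite lin_entry.
exact: (sqint_lin a (hx i) (hy i)).
Qed.

Lemma inL2_mulmx (M : 'M[R]_n) x : inL2 T x -> inL2 T (fun t => M *m x t).
Proof.
move=> hx i.
have -> : (fun t => (M *m x t) i 0) = \sum_j (fun t => M i j * x t j 0).
  by apply/funext => t; rewrite mxE fct_sumE.
change (sqint T (\sum_j (fun t => M i j * x t j 0))).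
apply: (@big_ind _ (fun f : R -> R => sqint T f)); first exact: sqint0.
  move=> f g hf hg; have -> : f + g = (fun t => 1 * f t + g t); last first.
    exact: sqint_lin.
  by apply/funext => t; rewrite mul1r.
move=> j _; have -> : (fun t => M i j * x t j 0) = fun t => M i j * x t j 0 + 0;
    last first.
  by apply: sqint_lin; [exact: hx | exact: sqint0].
by apply/funext => t; rewrite addr0.
Qed.

Lemma L2inner_integrable x y : inL2 T x -> inL2 T y ->
  mu.-integrable `]0, T[ (EFin \o (fun t => \sum_i x t i 0 * y t i 0)).
Proof.
move=> hx hy.
rewrite (_ : _ \o _ = fun t => (\sum_i (x t i 0 * y t i 0)%:E)%E); last first.
  by apply/funext => t; rewrite /= sumEFin.
by apply: integrable_sum => // i _; exact: (sqint_mul_integrable (hx i) (hy i)).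
Qed.

Lemma L2innerC x y : L2inner T x y = L2inner T y x.
Proof.
apply: eq_lebesgue_Rintegral => t _.
by apply: eq_bigr => i _; rewrite mulrC.
Qed.

Lemma lebesgue_Rintegral_lin (a : R) (f g : R -> R) :
  mu.-integrable `]0, T[ (EFin \o f) -> mu.-integrable `]0, T[ (EFin \o g) ->
  \int[mu]_(t in `]0, T[) (a * f t + g t) =
  a * \int[mu]_(t in `]0, T[) f t + \int[mu]_(t in `]0, T[) g t.
Proof.
move=> hf hg; rewrite RintegralD// ?RintegralZl//.
have := @integrableZl _ _ _ mu `]0, T[%classic (measurable_itv _) a _ hf.
by congr (mu.-integrable _ _); apply/funext => t; rewrite /= EFinM.
Qed.

Lemma L2inner_linl a x y z : inL2 T x -> inL2 T y -> inL2 T z ->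
  L2inner T (a *: x + y) z = a * L2inner T x z + L2inner T y z.
Proof.
move=> hx hy hz; rewrite /L2inner.
rewrite -lebesgue_Rintegral_lin; [|exact: L2inner_integrable..].
apply: eq_lebesgue_Rintegral => t _.
rewrite mulr_sumr -big_split/=; apply: eq_bigr => i _.
by rewrite lin_entry mulrDl mulrA.
Qed.

Lemma L2inner_ge0 x : 0 <= L2inner T x x.
Proof.
by apply: Rintegral_ge0 => t _; apply: sumr_ge0 => i _; rewrite -expr2 sqr_ge0.
Qed.

Lemma L2inner_ael x y z : inL2 T x -> inL2 T y -> inL2 T z ->
  ae_eqI T x y -> L2inner T x z = L2inner T y z.
Proof.
move=> hx hy hz xy; rewrite /L2inner /Rintegral; congr fine.
apply: ae_eq_integral => //.
- exact: (measurable_int mu (L2inner_integrable hx hz)).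
- exact: (measurable_int mu (L2inner_integrable hy hz)).
apply: (@filterS _ _ (ae_filter_ringOfSetsType mu)) xy => t xy tT.
by rewrite xy.
Qed.

(** Cauchy-Schwarz in quotient form. When y has norm 0 the quotient is 0 by the
convention on division, as in the definition of [DeltaN]. *)
Lemma L2inner_cauchy x y : inL2 T x -> inL2 T y ->
  L2inner T x y / L2norm T y <= L2norm T x.
Proof.
move=> hx hy.
have [y0|] := eqVneq (L2norm T y) 0.
  by rewrite y0 invr0 mulr0 sqrtr_ge0.
rewrite /L2norm sqrtr_eq0 -ltNge => y0.
rewrite ler_pdivrMr ?sqrtr_gt0// -sqrtrM ?L2inner_ge0//.
apply: le_trans (ler_norm _) _; rewrite -sqrtr_sqr ler_wsqrtr//.
set p := L2inner T x y; set q := L2inner T y y in y0 *.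
(* The squared norm of a y + x, to be used at its minimum a = - p / q. *)
have hs (a : R) : 0 <= a ^+ 2 * q + 2 * a * p + L2inner T x x.
  have := L2inner_ge0 (a *: y + x).
  have h := inL2_lin_closed.2 a y x hy hx.
  rewrite L2inner_linl// (L2innerC y) (L2innerC x) !L2inner_linl//.
  rewrite (L2innerC y x) -/p -/q => /le_trans; apply.
  by rewrite le_eqVlt; apply/orP; left; apply/eqP; ring.
have := hs (- p / q).
rewrite -(ler_pM2r y0) mul0r.
suff -> : ((- p / q) ^+ 2 * q + 2 * (- p / q) * p + L2inner T x x) * q =
  L2inner T x x * q - p ^+ 2 by rewrite subr_ge0.
by field; rewrite gt_eqF.
Qed.

End L2space.

(** * Weak derivatives of vector-valued functions *)

Section WeakDerivative.
Context (R : realType) (n : nat) (T : R).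
Local Notation mu := (@lebesgue_measure R).
Implicit Types x y z w : R -> 'cV[R]_n.

Lemma weak_derivative_lin a y1 y2 w1 w2 : inL2 T y1 -> inL2 T y2 ->
  weak_derivative T y1 w1 -> weak_derivative T y2 w2 ->
  weak_derivative T (a *: y1 + y2) (a *: w1 + w2).
Proof.
move=> hy1 hy2 [hw1 d1] [hw2 d2]; split; first exact: (inL2_lin_closed _ _).2.
move=> phi i tp.
have hp : sqint T phi by exact/sqint_continuous/(test_fun_continuous tp).
have hdp : sqint T (derive1 phi) by apply: sqint_continuous; case: tp.
rewrite (@eq_lebesgue_Rintegral _ _ _ (fun t =>
       a * (y1 t i 0 * derive1 phi t) + y2 t i 0 * derive1 phi t)); last first.
  by move=> t _; rewrite lin_entry mulrDl mulrA.
rewrite lebesgue_Rintegral_lin; last 2 first.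
- exact: (sqint_mul_integrable (hy1 i) hdp).
- exact: (sqint_mul_integrable (hy2 i) hdp).
rewrite [in RHS](@eq_lebesgue_Rintegral _ _ _ (fun t =>
       a * (w1 t i 0 * phi t) + w2 t i 0 * phi t)); last first.
  by move=> t _; rewrite lin_entry mulrDl mulrA.
rewrite [in RHS]lebesgue_Rintegral_lin; last 2 first.
- exact: (sqint_mul_integrable (hw1 i) hp).
- exact: (sqint_mul_integrable (hw2 i) hp).
by rewrite d1// d2// opprD mulrN.
Qed.

Lemma weak_derivative_unique y w1 w2 :
  weak_derivative T y w1 -> weak_derivative T y w2 -> ae_eqI T w1 w2.
Proof.
move=> [hw1 d1] [hw2 d2].
have hw : inL2 T (-1 *: w1 + w2) by exact: (inL2_lin_closed _ _).2.
have h i : {ae mu, forall t, t \in `]0, T[ -> (-1 *: w1 + w2) t i 0 = 0}.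
  apply: (fundamental_lemma (hw i)) => phi tp.
  have hp : sqint T phi by exact/sqint_continuous/(test_fun_continuous tp).
  rewrite (@eq_lebesgue_Rintegral _ _ _ (fun t =>
       -1 * (w1 t i 0 * phi t) + w2 t i 0 * phi t)); last first.
    by move=> t _; rewrite lin_entry mulrDl mulrA.
  rewrite lebesgue_Rintegral_lin; last 2 first.
  - exact: (sqint_mul_integrable (hw1 i) hp).
  - exact: (sqint_mul_integrable (hw2 i) hp).
  by rewrite mulN1r -d1// -[X in _ + X]opprK -d2// subrr.
have F := ae_filter_ringOfSetsType mu.
have := @filter_forall _ _ _ _ F h.
apply: (@filterS _ _ F) => t ht tT; apply/colP => i.
by have := ht i tT; rewrite lin_entry mulN1r addrC => /eqP;
  rewrite subr_eq0 => /eqP.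
Qed.

(** H^1 without the continuity of the representative. *)
Definition weakly_differentiable : set (R -> 'cV[R]_n) :=
  [set y | inL2 T y /\ exists w, weak_derivative T y w].

Lemma wderivP y : weakly_differentiable y -> weak_derivative T y (wderiv T y).
Proof. by move=> [_ [w hw]]; apply: (xgetPex _ (ex_intro _ w hw)). Qed.

Lemma weakly_differentiable_lin_closed : lin_closed weakly_differentiable.
Proof.
split.
  split; first exact: (inL2_lin_closed _ _).1.
  exists 0; split; first exact: (inL2_lin_closed _ _).1.
  move=> phi i _.
  rewrite (@eq_lebesgue_Rintegral _ _ _ (fun=> 0)); last first.
    by move=> t _; rewrite -[X in X * _]/((0 : 'cV[R]_n) i 0) mxE mul0r.
  rewrite [in RHS](@eq_lebesgue_Rintegral _ _ _ (fun=> 0)); last first.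
    by move=> t _; rewrite -[X in X * _]/((0 : 'cV[R]_n) i 0) mxE mul0r.
  by rewrite Rintegral_cst//= mul0r oppr0.
move=> a x y [hx [w1 d1]] [hy [w2 d2]].
split; first exact: (inL2_lin_closed _ _).2.
by exists (a *: w1 + w2); exact: weak_derivative_lin.
Qed.

Lemma ramp_weakly_differentiable (c : R) (u : 'cV[R]_n) :
  weakly_differentiable (fun t => ramp c t *: u).
Proof.
have cr : sqint T (ramp c) by exact/sqint_continuous/ramp_continuous.
have cs : sqint T (fun t => (c <= t)%R%:R).
  apply: (@sqint_bounded _ _ _ 1).
    rewrite (_ : (fun _ => _) = (\1_(`[c, +oo[%classic : set R) : R -> R)).
      exact: measurable_indic.
    by apply/funext => t; rewrite indicE mem_setE in_itv/= andbT.
  by move=> t _; case: (c <= t); rewrite ?normr1 ?normr0.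
have hL (f : R -> R) : sqint T f -> inL2 T (fun t => f t *: u).
  move=> hf; apply/inL2P => i.
  have -> : (fun t => (f t *: u) i 0) = (fun t => u i 0 * f t + 0).
    by apply/funext => t; rewrite mxE addr0 mulrC.
  exact: (sqint_lin _ hf (sqint0 T)).
split; first exact: hL.
exists (fun t => (c <= t)%R%:R *: u); split; first exact: hL.
move=> phi i tp.
have hp : sqint T phi by exact/sqint_continuous/(test_fun_continuous tp).
have hdp : sqint T (derive1 phi) by apply: sqint_continuous; case: tp.
have E (f g : R -> R) : sqint T f -> sqint T g ->
    \int[mu]_(t in `]0, T[) ((f t *: u) i 0 * g t) =
    u i 0 * \int[mu]_(t in `]0, T[) (f t * g t).
  move=> hf hg.
  rewrite -RintegralZl//; last exact: (sqint_mul_integrable hf hg).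
  by apply: eq_lebesgue_Rintegral => t _; rewrite mxE -mulrA mulrCA.
by rewrite !E// (ramp_by_parts _ tp) mulrN.
Qed.

Lemma hat_weakly_differentiable (K k : nat) (u : 'cV[R]_n) : 0 < T -> (0 < K)%N ->
  weakly_differentiable (fun t => hat T K k t *: u).
Proof.
move=> T0 K0; have [L0 L] := weakly_differentiable_lin_closed.
pose h := T / K%:R; pose c := node T K k.
rewrite (_ : (fun _ => _) =
  h^-1 *: ((-2) *: (fun t => ramp c t *: u) +
   (1 *: (fun t => ramp (c - h) t *: u) + (fun t => ramp (c + h) t *: u))) + 0).
  by apply: (L) => //; apply: (L); [|apply: (L)]; exact: ramp_weakly_differentiable.
apply/funext => t; rewrite hat_ramp// -/h -/c addr0 scale1r.
rewrite -[RHS]/(h^-1 *: ((-2) *: (ramp c t *: u) +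
  (ramp (c - h) t *: u + ramp (c + h) t *: u))).
rewrite !scalerA -!scalerDl scalerA; congr (_ *: _); ring.
Qed.

End WeakDerivative.

(** * Linearity of the adjoint operator *)

Section Operator.
Context (R : realType) (n : nat) (T : R) (E A : 'M[R]_n).
Local Notation mu := (@lebesgue_measure R).
Local Notation W := (@weakly_differentiable R n T).
Implicit Types x y z w : R -> 'cV[R]_n.

Lemma Bstar_inL2 y : W y -> inL2 T (Bstar T E A y).
Proof.
move=> hy; have [hw _] := wderivP hy.
rewrite (_ : Bstar _ _ _ _ = (-1) *: (fun t => E^T *m wderiv T y t) +
   ((-1) *: (fun t => A^T *m y t) + 0)).
  have [L0 L] := @inL2_lin_closed R n T.
  by apply: (L); [|apply: (L) => //]; apply: inL2_mulmx => //; case: hy.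
by apply/funext => t; rewrite addr0 !scaleN1r.
Qed.

(** [wderiv] is a choice among weak derivatives, so [Bstar] is linear only
through the uniqueness of weak derivatives. *)
Lemma Bstar_lin a y1 y2 : W y1 -> W y2 ->
  ae_eqI T (Bstar T E A (a *: y1 + y2)) (a *: Bstar T E A y1 + Bstar T E A y2).
Proof.
move=> h1 h2.
have h12 := (weakly_differentiable_lin_closed n T).2 a _ _ h1 h2.
have := weak_derivative_unique (wderivP h12)
  (weak_derivative_lin a h1.1 h2.1 (wderivP h1) (wderivP h2)).
apply: (@filterS _ _ (ae_filter_ringOfSetsType mu)) => t ht tT.
rewrite -[RHS]/(a *: (- (E^T *m wderiv T y1 t) - A^T *m y1 t) +
  (- (E^T *m wderiv T y2 t) - A^T *m y2 t)).
rewrite /Bstar (ht tT).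
rewrite -[(a *: y1 + y2) t]/(a *: y1 t + y2 t).
rewrite -[(a *: wderiv T y1 + _) t]/(a *: wderiv T y1 t + wderiv T y2 t).
rewrite !mulmxDr -!scalemxAr scalerDr !scalerN !opprD -!addrA.
by congr (_ + _); rewrite addrCA.
Qed.

Lemma Bstar0 : ae_eqI T (Bstar T E A 0) 0.
Proof.
have h0 := (weakly_differentiable_lin_closed n T).1.
have := Bstar_lin (-1) h0 h0; rewrite scaler0 addr0 scaleN1r addNr.
exact.
Qed.

Lemma Bstar_image_lin_closed (Y : set (R -> 'cV[R]_n)) :
  lin_closed Y -> Y `<=` W -> lin_closed (Bstar_image T E A Y).
Proof.
have F := ae_filter_ringOfSetsType mu.
have [L0 L] := @inL2_lin_closed R n T.
move=> [Y0 YL] YW; split.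
  split => //; exists 0 => //; apply: (@filterS _ _ F) Bstar0 => t h tT.
  by rewrite h.
move=> a x1 x2 [hx1 [y1 Yy1 e1]] [hx2 [y2 Yy2 e2]]; split; first exact: L.
exists (a *: y1 + y2); first exact: YL.
have e3 := Bstar_lin a (YW _ Yy1) (YW _ Yy2).
apply: (@filterS3 _ _ F) e1 e2 e3 => t e1 e2 e3 tT.
rewrite e3// -[LHS]/(a *: x1 t + x2 t) e1// e2//.
Qed.

End Operator.

(** * The discrete test space *)

Section DiscreteSpace.
Context (R : realType) (n : nat) (T : R) (K : nat) (E : 'M[R]_n).
Context (v : (\dim (kerT E)).-tuple 'cV[R]_n).

Lemma Yh_lin_closed : lin_closed (Yh T K v).
Proof.
split.
  by exists 0, 0; split; [exact: (span_fam_lin_closed _).1..|rewrite addr0].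
move=> a _ _ [x1 [x2 [h1 h2 ->]]] [y1 [y2 [k1 k2 ->]]].
exists (a *: x1 + y1), (a *: x2 + y2); split.
- exact: (span_fam_lin_closed _).2.
- exact: (span_fam_lin_closed _).2.
- by rewrite scalerDr addrACA.
Qed.

Lemma Yh_weakly_differentiable : 0 < T -> (0 < K)%N ->
  Yh T K v `<=` @weakly_differentiable R n T.
Proof.
move=> T0 K0 _ [_ [_ [[c1 ->] [c2 ->] ->]]].
have L := weakly_differentiable_lin_closed n T.
rewrite -[X in X + _]scale1r; apply: L.2; apply: lin_closed_sum => // i;
  exact: hat_weakly_differentiable.
Qed.

(** The supremum of an empty set would be -oo; a nonzero test function is needed
when the error vanishes. *)
Lemma Yh_neq0 : (0 < n)%N -> (0 < K)%N -> exists2 y, Yh T K v y & y <> 0.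
Proof.
move=> n0 K0; pose i0 := (Ordinal K0, Ordinal n0).
pose F (ki : 'I_K * 'I_n) : R -> 'cV[R]_n :=
  fun t => hat T K ki.1 t *: delta_mx ki.2 0.
exists (F i0).
  exists (F i0), 0; split; last by rewrite addr0.
  - exists (fun i => (i == i0)%:R); rewrite (bigD1 i0)// eqxx scale1r.
    rewrite big1 /= ?addr0//.
    by move=> i /negbTE ->; rewrite scale0r.
  - exact: (span_fam_lin_closed _).1.
move=> /(congr1 (fun f : R -> 'cV[R]_n => f 0 (Ordinal n0) 0)).
rewrite -[RHS]/((0 : 'cV[R]_n) (Ordinal n0) 0) /F !mxE !eqxx mulr1.
rewrite /hat /node mul0r subr0 normr0 mul0r subr0 => /eqP.
by rewrite (max_idPr _) ?ler01// oner_eq0.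
Qed.

End DiscreteSpace.

(** * The residual and the error *)

(** The dual norm of the functional y |-> (e, Bstar y) is the norm of e when e
lies in the image of [Bstar]: Cauchy-Schwarz bounds it, and a preimage z of e
attains the bound. If z = 0, then e vanishes almost everywhere and every nonzero
element of Y gives the value 0. *)
Lemma residual_dual_norm (R : realType) (n : nat) (T : R) (E A : 'M[R]_n)
    (Y : set (R -> 'cV[R]_n)) (e : R -> 'cV[R]_n) (f : (R -> 'cV[R]_n) -> R)
    (xN : R -> 'cV[R]_n) :
  Y `<=` @weakly_differentiable R n T ->
  (exists2 y, Y y & y <> 0) ->
  Bstar_image T E A Y e ->
  (forall y, Y y -> f y - bform T E A xN y = L2inner T e (Bstar T E A y)) ->
  (L2norm T e)%:E = DeltaN T E A Y f xN.
Proof.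
move=> YW [y1 Yy1 y10] [he [z Yz ez]] res.
have inB y : Y y -> inL2 T (Bstar T E A y) by move=> /YW; exact: Bstar_inL2.
apply/esym/eqP; rewrite eq_le; apply/andP; split.
  apply: ge_ereal_sup => _ [y [Yy _] <-].
  by rewrite lee_fin res//; apply: L2inner_cauchy => //; exact: inB.
have [z0|z0] := pselect (z = 0).
  have e0 : ae_eqI T e 0.
    have F := ae_filter_ringOfSetsType (@lebesgue_measure R).
    have B0 := @Bstar0 R n T E A; rewrite z0 in ez.
    apply: (@filterS2 _ _ F) ez B0 => t h1 h2 tT.
    by rewrite h1// h2.
  have [L0 _] := @inL2_lin_closed R n T.
  have E0 x : inL2 T x -> L2inner T e x = 0.
    move=> hx; rewrite (L2inner_ael he L0 hx e0).
    have := L2inner_linl (-1) hx hx hx.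
    by rewrite mulN1r addNr scaleN1r addNr.
  apply: ereal_sup_ubound; exists y1 => //.
  by rewrite /L2norm res// !E0//; [rewrite mul0r sqrtr0 | exact: inB].
apply: ereal_sup_ubound; exists z => //.
rewrite res// /Ynorm /L2norm.
have hz := inB _ Yz.
rewrite -(L2inner_ael he hz hz ez) L2innerC -(L2inner_ael he hz he ez).
have [->|] := eqVneq (Num.sqrt (L2inner T e e)) 0.
  by rewrite invr0 mulr0.
move=> s0; congr EFin; apply/(mulIf s0).
by rewrite divfK// -expr2 sqr_sqrtr// L2inner_ge0.
Qed.

Theorem mainTheorem3 (R : realType) (n m K p Q N : nat) (T : R)
    (E A : 'M[R]_n) (B : 'M[R]_(n, m))
    (P2 : set 'rV[R]_p) (theta : 'I_Q -> 'rV[R]_p -> R)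
    (xbar dxbar : 'I_Q -> R -> 'cV[R]_n)
    (v : (\dim (kerT E)).-tuple 'cV[R]_n)
    (muN : 'I_N -> param R m K p) :
  (0 < n)%N -> (0 < K)%N -> 0 < T ->
  regular_pencil E A ->
  (forall q, C1_with T (xbar q) (dxbar q)) ->
  basis_of (kerT E) v ->
  (forall i, P2 (muN i).2) ->
  let f := rhs T E A B theta xbar dxbar in
  let YNcal := Yh T K v in
  let XNcal := Bstar_image T E A YNcal in
  let SN := range muN in
  forall (mu : param R m K p) (x xN : R -> 'cV[R]_n),
    P2 mu.2 ->
    galerkin_sol T E A XNcal YNcal (f mu) x ->
    galerkin_sol T E A (XN T E A XNcal YNcal f SN) (YN T E A XNcal YNcal f SN)
      (f mu) xN ->
    (L2norm T (x - xN))%:E = DeltaN T E A YNcal (f mu) xN.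
Proof.
move=> n0 K0 T0 _ _ _ _ f Y X SN mu x xN _ [Xx fx] [XNxN _].
have YW : Y `<=` weakly_differentiable T by exact: Yh_weakly_differentiable.
have lX : lin_closed X.
  by apply: Bstar_image_lin_closed => //; exact: Yh_lin_closed.
have XxN : X xN by move: XNxN; apply: span_set_sub => // y [nu _ []].
have eE : x - xN = -1 *: xN + x by rewrite scaleN1r addrC.
apply: residual_dual_norm => //.
- exact: Yh_neq0.
- by rewrite eE; exact: lX.2.
move=> y Yy; rewrite -fx// /bform eE.
rewrite L2inner_linl//; [|exact: XxN.1|exact: Xx.1|exact/Bstar_inL2/YW].
by rewrite mulN1r addrC.
Qed.
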